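(* Let $\Lambda$ be a finite dimensional eventually periodic algebra over a field $k$. Then $\operatorname{inj.dim}_{\Lambda}\Lambda < \infty$ if and only if $\operatorname{inj.dim}_{\Lambda^{\mathrm{op}}}\Lambda < \infty$.
   Context: Rings are associative and unital; modules are left modules. $\Lambda^{\mathrm e}=\Lambda\otimes_k\Lambda^{\mathrm{op}}$; $\Lambda^{\mathrm e}$-modules are identified with $\Lambda$-bimodules on which $k$ acts centrally. For a finite dimensional algebra $A$ and an $A$-module $M$, the syzygy $\Omega_A(M)$ is the kernel of a projective cover of $M$, $\Omega_A^0(M)=M$ and $\Omega_A^n(M)=\Omega_A(\Omega_A^{n-1}(M))$. $M$ is periodic if $\Omega_A^p(M)\cong M$ as $A$-modules for some $p>0$, and eventually periodic if $\Omega_A^n(M)$ is periodic for some $n\ge 0$. The algebra $\Lambda$ is eventually periodic if the regular bimodule $\Lambda$ is eventually periodic as a $\Lambda^{\mathrm e}$-module. *)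

(* Defs.v *)
From HB Require Import structures.
From mathcomp Require Import all_boot all_order all_algebra all_field.

Set Implicit Arguments.
Unset Strict Implicit.
Unset Printing Implicit Defensive.

Import GRing.Theory VectorInternalTheory.
Local Open Scope ring_scope.

(** Modules are left modules over a possibly noncommutative ring, with no
    finiteness condition; right R-modules are the modules over [R^c]. *)
Section Modules.
Variable R : nzRingType.
Implicit Types M N P I : lmodType R.

Definition epi M N (f : {linear M -> N}) : Prop := forall y, exists x, f x = y.

Definition exact_at M N P (f : {linear M -> N}) (g : {linear N -> P}) : Prop :=
  forall y, g y = 0 <-> exists x, f x = y.

Definition linear_iso M N : Prop := exists f : {linear M -> N}, bijective f.

Definition projective_module P : Prop :=
  forall M N (g : {linear M -> N}) (f : {linear P -> N}), epi g ->
    exists h : {linear P -> M}, forall x, g (h x) = f x.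

Definition injective_module I : Prop :=
  forall M N (g : {linear M -> N}) (f : {linear M -> I}), injective g ->
    exists h : {linear N -> I}, forall x, h (g x) = f x.

Definition essential_epi P M (p : {linear P -> M}) : Prop :=
  epi p /\ forall (X : lmodType R) (g : {linear X -> P}),
    (forall y, exists x, p (g x) = y) -> epi g.

Definition projective_cover P M (p : {linear P -> M}) : Prop :=
  projective_module P /\ essential_epi p.

(** Syzygies are only determined up to isomorphism, so they are relations:
    [is_syzygy M N] says that N is (isomorphic to) the kernel of a projective
    cover of M, and [is_nth_syzygy n M N] that N is an n-th syzygy of M. *)
Definition is_syzygy M N : Prop :=
  exists (P : lmodType R) (p : {linear P -> M}) (i : {linear N -> P}),
    [/\ projective_cover p, injective i & exact_at i p].

Fixpoint is_nth_syzygy (n : nat) M N : Prop :=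
  match n with
  | 0 => linear_iso M N
  | n'.+1 => exists L : lmodType R, is_nth_syzygy n' M L /\ is_syzygy L N
  end.

Definition periodic M : Prop :=
  exists (p : nat) (N : lmodType R),
    [/\ (0 < p)%N, is_nth_syzygy p M N & linear_iso N M].

Definition eventually_periodic M : Prop :=
  exists (n : nat) (N : lmodType R), is_nth_syzygy n M N /\ periodic N.

Definition injective_resolution M (I : nat -> lmodType R)
    (eta : {linear M -> I 0}) (d : forall i, {linear I i -> I i.+1}) : Prop :=
  [/\ forall i, injective_module (I i), injective eta, exact_at eta (d 0)
    & forall i, exact_at (d i) (d i.+1)].

Definition inj_dim_le M (n : nat) : Prop :=
  exists (I : nat -> lmodType R) (eta : {linear M -> I 0})
         (d : forall i, {linear I i -> I i.+1}),
    injective_resolution eta d /\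
    forall i, (n < i)%N -> forall x : I i, x = 0.

Definition finite_inj_dim M : Prop := exists n, inj_dim_le M n.

End Modules.

(** MathComp equips the converse ring [A^c] with no scalar action. *)
Section Opposite.
Variables (k : fieldType) (A : falgType k).

HB.instance Definition _ := Vector.copy A^c A.

Fact opp_scalerAl (a : k) (x y : A^c) : a *: (x * y : A^c) = (a *: x : A^c) * y.
Proof. exact: (scalerAr a (y : A) (x : A)). Qed.
HB.instance Definition _ :=
  GRing.LSemiModule_isLSemiAlgebra.Build k A^c opp_scalerAl.

Fact opp_scalerAr (a : k) (x y : A^c) : a *: (x * y : A^c) = x * (a *: y : A^c).
Proof. exact: (scalerAl a (y : A) (x : A)). Qed.
HB.instance Definition _ :=
  GRing.LSemiAlgebra_isSemiAlgebra.Build k A^c opp_scalerAr.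

HB.instance Definition _ := Algebra_isFalgebra.Build k A^c.
End Opposite.

(** The tensor product over k of finite dimensional spaces, in coordinates: in
    the bases given by the coordinate isomorphisms [v2r], the (i, j) entry of a
    matrix is the coefficient of [vb i] tensor [vb j]. *)
Section Tensor.
Variable k : fieldType.

Definition vb (V : vectType k) (i : 'I_(dim V)) : V := r2v (delta_mx 0 i).

Lemma vb_sum (V : vectType k) (v : V) : v = \sum_i v2r v 0 i *: vb i.
Proof.
rewrite -{1}[v]v2rK {1}[v2r v]row_sum_delta linear_sum.
by apply: eq_bigr => i _; rewrite linearZ.
Qed.

Definition tensor (U V : vectType k) : Type := 'M[k]_(dim U, dim V).
HB.instance Definition _ (U V : vectType k) :=
  Vector.copy (tensor U V) 'M[k]_(dim U, dim V).

Section Vect.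
Variables U V : vectType k.
Implicit Types (u : U) (v : V) (x y : tensor U V) (a : k).

Definition tens u v : tensor U V := (v2r u)^T *m v2r v.

Lemma tensDl u1 u2 v : tens (u1 + u2) v = tens u1 v + tens u2 v.
Proof. by rewrite /tens linearD linearD mulmxDl. Qed.
Lemma tensDr u v1 v2 : tens u (v1 + v2) = tens u v1 + tens u v2.
Proof. by rewrite /tens linearD mulmxDr. Qed.
Lemma tensZl a u v : tens (a *: u) v = a *: tens u v.
Proof. by rewrite /tens !linearZ /= scalemxAl. Qed.
Lemma tensZr a u v : tens u (a *: v) = a *: tens u v.
Proof. by rewrite /tens linearZ /= scalemxAr. Qed.

Lemma tens_sum x : x = \sum_i \sum_j x i j *: tens (vb i) (vb j).
Proof.
rewrite {1}[x]matrix_sum_delta; apply: eq_bigr => i _; apply: eq_bigr => j _.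
by rewrite /tens /vb !r2vK trmx_delta mul_delta_mx.
Qed.

Lemma tens_neq0 u v : u != 0 -> v != 0 -> tens u v != 0.
Proof.
have nz (X : vectType k) (w : X) : w != 0 -> v2r w != 0.
  by apply: contraNneq => w0; apply/eqP/v2r_inj; rewrite w0 linear0.
move=> /nz/rV0Pn[i ui] /nz/rV0Pn[j vj]; apply/eqP => /matrixP/(_ i j)/eqP.
by rewrite !mxE big_ord1 !mxE mulf_eq0 (negPf ui) (negPf vj).
Qed.

Definition bilinear_map (T : lmodType k) (f : U -> V -> T) : Prop :=
  [/\ forall a u1 u2 v, f (a *: u1 + u2) v = a *: f u1 v + f u2 v
    & forall a u v1 v2, f u (a *: v1 + v2) = a *: f u v1 + f u v2].

(** The linear map on the tensor product induced by a bilinear map f. *)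
Definition tlift (T : lmodType k) (f : U -> V -> T) x : T :=
  \sum_i \sum_j x i j *: f (vb i) (vb j).

Lemma tliftP (T : lmodType k) (f : U -> V -> T) a x y :
  tlift f (a *: x + y) = a *: tlift f x + tlift f y.
Proof.
rewrite /tlift scaler_sumr -big_split; apply: eq_bigr => i _ /=.
rewrite scaler_sumr -big_split; apply: eq_bigr => j _ /=.
by rewrite !mxE scalerDl scalerA.
Qed.

Lemma tliftE (T : lmodType k) (f : U -> V -> T) u v :
  bilinear_map f -> tlift f (tens u v) = f u v.
Proof.
case=> fl fr.
have fDl u1 u2 w : f (u1 + u2) w = f u1 w + f u2 w.
  by have := fl 1 u1 u2 w; rewrite !scale1r.
have fDr w v1 v2 : f w (v1 + v2) = f w v1 + f w v2.
  by have := fr 1 w v1 v2; rewrite !scale1r.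
have f0l w : f 0 w = 0 by apply: (addIr (f 0 w)); rewrite -fDl !add0r.
have f0r w : f w 0 = 0 by apply: (addIr (f w 0)); rewrite -fDr !add0r.
have fZl a u1 w : f (a *: u1) w = a *: f u1 w.
  by have := fl a u1 0 w; rewrite addr0 f0l addr0.
have fZr a w v1 : f w (a *: v1) = a *: f w v1.
  by have := fr a w v1 0; rewrite addr0 f0r addr0.
rewrite [in RHS](vb_sum u) (big_morph (f^~ v) (fun p q => fDl p q v) (f0l v)).
apply: eq_bigr => i _; rewrite fZl [in RHS](vb_sum v).
rewrite (big_morph _ (fDr _) (f0r _)) scaler_sumr; apply: eq_bigr => j _.
by rewrite fZr scalerA /tens mxE big_ord1 mxE.
Qed.

Lemma eq_tlift (T : lmodType k) (f g : U -> V -> T) x :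
  (forall u v, f u v = g u v) -> tlift f x = tlift g x.
Proof. by move=> fg; do 2!apply: eq_bigr => ? _; rewrite fg. Qed.

Lemma tlift_linear_map (T : lmodType k) (Z : lmodType k)
    (f : U -> V -> Z -> T) x :
  (forall u v, linear (f u v)) -> linear (fun z => tlift (fun u v => f u v z) x).
Proof.
move=> lf a z z'; rewrite /tlift scaler_sumr -big_split; apply: eq_bigr => i _ /=.
rewrite scaler_sumr -big_split; apply: eq_bigr => j _ /=.
by rewrite lf scalerDr !scalerA mulrC.
Qed.

Lemma tens_ext (T : lmodType k) (f g : tensor U V -> T) :
    linear f -> linear g -> (forall u v, f (tens u v) = g (tens u v)) ->
  f =1 g.
Proof.
move=> lf lg fg x.
have h0 (h : tensor U V -> T) : linear h -> h 0 = 0.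
  move=> lh; have := lh 1 0 0; rewrite !scale1r addr0 => e.
  by apply: (addIr (h 0)); rewrite add0r -e.
pose K y := f y = g y.
have KP a y z : K y -> K z -> K (a *: y + z).
  by rewrite /K lf lg => -> ->.
have KD y z : K y -> K z -> K (y + z) by move=> /(KP 1)/[apply]; rewrite scale1r.
have K0 : K 0 by rewrite /K !h0.
rewrite -/(K x) (tens_sum x); apply: big_ind => // i _; apply: big_ind => // j _.
by rewrite -[_ *: _]addr0; apply: KP => //; apply: fg.
Qed.

End Vect.
End Tensor.

Section TensorAlgebra.
Variables (k : fieldType) (A B : falgType k).
Local Notation T := (tensor A B).
Implicit Types (a : A) (b : B) (x y z : T).

Definition tens_one : T := tens 1 1.

(** The multiplication is the bilinear extension of
    (a tensor b) (a' tensor b') = a a' tensor b b'; see [tens_mulE]. *)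
Definition tens_mul x y : T :=
  tlift (fun a b => tlift (fun a' b' => tens (a * a') (b * b')) y) x.

Let bil_l a b : bilinear_map (fun a' b' => tens (a * a') (b * b') : T).
Proof.
by split=> *; rewrite mulrDr -scalerAr ?(tensDl, tensDr) ?(tensZl, tensZr).
Qed.

Let bil_r a b : bilinear_map (fun a' b' => tens (a' * a) (b' * b) : T).
Proof.
by split=> *; rewrite mulrDl -scalerAl ?(tensDl, tensDr) ?(tensZl, tensZr).
Qed.

Let lin_l x : linear (tens_mul x).
Proof. by apply: tlift_linear_map => a b c y z; rewrite tliftP. Qed.

Let lin_r y : linear (tens_mul^~ y).
Proof. by move=> c x z; rewrite /tens_mul tliftP. Qed.

Lemma tens_mulE a b a' b' :
  tens_mul (tens a b) (tens a' b') = tens (a * a') (b * b').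
Proof.
rewrite /tens_mul (eq_tlift _ (fun a b => tliftE a' b' (bil_l a b))).
exact: tliftE (bil_r _ _).
Qed.

Fact tens_mulA : associative tens_mul.
Proof.
move=> x y z; move: x; apply: tens_ext; [exact: lin_r | |].
  by move=> c x x'; rewrite !lin_r.
move=> a b; move: y; apply: tens_ext.
- by move=> c y y'; rewrite lin_r lin_l.
- by move=> c y y'; rewrite lin_l lin_r.
move=> a' b'; move: z; apply: tens_ext.
- by move=> c z z'; rewrite !lin_l.
- exact: lin_l.
by move=> a'' b''; rewrite !tens_mulE !mulrA.
Qed.

Fact tens_mul1l : left_id tens_one tens_mul.
Proof.
apply: (@tens_ext k A B T (tens_mul tens_one) id) => // a b.
by rewrite tens_mulE !mul1r.
Qed.

Fact tens_mul1r : right_id tens_one tens_mul.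
Proof.
apply: (@tens_ext k A B T (tens_mul^~ tens_one) id) => // a b.
by rewrite tens_mulE !mulr1.
Qed.

Fact tens_mulDl : left_distributive tens_mul +%R.
Proof. by move=> x y z; have := lin_r z 1 x y; rewrite !scale1r. Qed.

Fact tens_mulDr : right_distributive tens_mul +%R.
Proof. by move=> x y z; have := lin_l x 1 y z; rewrite !scale1r. Qed.

Fact tens_one_neq0 : tens_one != 0.
Proof. by rewrite tens_neq0 ?oner_neq0. Qed.

HB.instance Definition _ := GRing.Zmodule_isNzRing.Build T
  tens_mulA tens_mul1l tens_mul1r tens_mulDl tens_mulDr tens_one_neq0.

Fact tens_scalerAl (c : k) x y : c *: (x * y) = (c *: x) * y.
Proof.
have z0 : tens_mul 0 y = 0 := mul0r y.
by have := lin_r y c x 0; rewrite /= z0 !addr0.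
Qed.
HB.instance Definition _ :=
  GRing.LSemiModule_isLSemiAlgebra.Build k T tens_scalerAl.

Fact tens_scalerAr (c : k) x y : c *: (x * y) = x * (c *: y).
Proof.
have z0 : tens_mul x 0 = 0 := mulr0 x.
by have := lin_l x c y 0; rewrite /= z0 !addr0.
Qed.
HB.instance Definition _ :=
  GRing.LSemiAlgebra_isSemiAlgebra.Build k T tens_scalerAr.

HB.instance Definition _ := Algebra_isFalgebra.Build k T.

End TensorAlgebra.

Section Enveloping.
Variables (k : fieldType) (A : falgType k).

Definition enveloping : Type := tensor A A^c.
HB.instance Definition _ := Falgebra.on enveloping.

(** A as a module over its enveloping algebra; the action is the linear
    extension of (a tensor b) v = a v b; see [bimod_scaleE]. *)
Definition regular_bimodule : Type := A.
HB.instance Definition _ := GRing.Zmodule.on regular_bimodule.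

Definition bimod_scale (x : enveloping) (v : regular_bimodule) :
  regular_bimodule :=
  tlift (fun (a : A) (b : A^c) => a * (v : A) * (b : A)) x.

Let bil (v : A) : bilinear_map (fun (a : A) (b : A^c) => a * v * (b : A)).
Proof.
split=> c a b; first by move=> d; rewrite !mulrDl -!scalerAl.
by move=> d; rewrite mulrDr -scalerAr.
Qed.

Lemma bimod_scaleE (a : A) (b : A^c) v :
  bimod_scale (tens a b) v = a * (v : A) * (b : A).
Proof. exact: tliftE (bil v). Qed.

Let lin_l v : linear (bimod_scale^~ v : enveloping -> A).
Proof. by move=> c x y; rewrite /bimod_scale tliftP. Qed.

Let lin_r x : linear (bimod_scale x : A -> A).
Proof.
apply: tlift_linear_map => a b c v w.
by rewrite mulrDr mulrDl -scalerAr -scalerAl.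
Qed.

Fact bimod_scalerA x y v :
  bimod_scale x (bimod_scale y v) = bimod_scale (x * y) v.
Proof.
move: x; apply: (@tens_ext k A A^c A).
- exact: lin_l.
- by move=> c x x'; rewrite mulrDl -scalerAl lin_l.
move=> a b; move: y; apply: (@tens_ext k A A^c A).
- by move=> c y y'; rewrite lin_l lin_r.
- by move=> c y y'; rewrite mulrDr -scalerAr lin_l.
move=> a' b'; rewrite [_ * _]tens_mulE !bimod_scaleE.
by rewrite -[RHS]/(a * a' * (v : A) * ((b' : A) * (b : A))) !mulrA.
Qed.

Fact bimod_scale1r : left_id 1 bimod_scale.
Proof. by move=> v; rewrite bimod_scaleE mul1r mulr1. Qed.

Fact bimod_scalerDr : right_distributive bimod_scale +%R.
Proof. by move=> x v w; have := lin_r x 1 v w; rewrite !scale1r. Qed.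

Fact bimod_scalerDl v : {morph bimod_scale^~ v : x y / x + y}.
Proof. by move=> x y; have := lin_l v 1 x y; rewrite !scale1r. Qed.

HB.instance Definition _ := GRing.Zmodule_isLmodule.Build enveloping
  regular_bimodule bimod_scalerA bimod_scale1r bimod_scalerDr bimod_scalerDl.

End Enveloping.

Definition eventually_periodic_algebra (k : fieldType) (A : falgType k) : Prop :=
  eventually_periodic (regular_bimodule A : lmodType (enveloping A)).

(* Main.v *)
From HB Require Import structures.
Require Import Defs.
From mathcomp Require Import all_boot all_order all_algebra all_field.
From mathcomp Require Import boolp classical_sets.

Set Implicit Arguments.
Unset Strict Implicit.
Unset Printing Implicit Defensive.

Import GRing.Theory VectorInternalTheory.
Local Open Scope ring_scope.

(** Write A for the algebra, B for its opposite and E for the enveloping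
    algebra. Suppose that A has finite injective dimension d as a left module,
    and let N be a periodic n-th syzygy of the bimodule A. The functor
    [dual M] = Hom_B(M, B) on bimodules turns a projective bimodule resolution
    of A into a coresolution of the right module A, with injective terms
    ([dual_injective]) and n-th cosyzygy [dual N]. So it is enough that
    [dual N] is injective.

    The hypothesis on A enters through a vanishing statement at the level of
    bimodules: Ext_E^i(M, E) = 0 for i > d when M is projective as a right
    module. Indeed E is A tensored over k with B, so a coresolution
    0 -> A -> I_0 -> ... -> I_d -> 0 by injective left modules yields a
    coresolution of E by the bimodules [tensorB I_j], that is, I_j tensored
    over k with B. These are injective relatively to the short exact
    sequences that split over B ([tensorB_relative_injective]), and dimension
    shifting gives the vanishing ([extend_to_tensorB], [extend_to_projective]).

    As N is periodic, it is an m-th syzygy of itself for arbitrarily large m.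
    By the vanishing, the identity of N extends to a chain map from this long
    periodic resolution of N to the given resolution of the bimodule A, and at
    the other end one gets a bimodule map from some syzygy of N to A. That map
    need not factor through a projective bimodule, but after applying [dual]
    it does factor through an injective: [dual] of the bimodule A is the free
    module B, and one can lift along surjections from it. Propagating
    this factorization back along the chain map, by injectivity of the terms,
    shows that the identity of [dual N] factors through the injective module
    [dual P], with P the last projective in the periodic resolution
    ([lift_dual], [dual_periodic_injective]).

    The two implications are the same statement with the two factors of E
    exchanged. The data shared by both cases is [enveloping_setting], and
    [finite_inj_dim_transfer] is the implication in that setting. *)

(** * Modules and finite injective coresolutions *)

Section Modules.
Variable R : nzRingType.
Implicit Types M N P I X Y Z W : lmodType R.

Lemma linear_map M N (f : M -> N) :
  (forall a x y, f (a *: x + y) = a *: f x + f y) ->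
  exists g : {linear M -> N}, g =1 f.
Proof.
move=> fP; pose g := HB.pack_for {linear M -> N} f (GRing.isLinear.Build R M N *:%R f fP).
by exists g.
Qed.

Lemma factor_through_mono X Y W (i : {linear W -> Y}) (f : {linear X -> Y}) :
    injective i -> (forall x, exists w, i w = f x) ->
  exists g : {linear X -> W}, forall x, i (g x) = f x.
Proof.
move=> iI /choice[g gP].
have [a x y|h hE] := @linear_map _ _ g; last by exists h => x; rewrite hE.
by apply: iI; rewrite linearP !gP linearP.
Qed.

Lemma factor_through_epi X Y W (p : {linear X -> Y}) (f : {linear X -> W}) :
    epi p -> (forall x, p x = 0 -> f x = 0) ->
  exists g : {linear Y -> W}, forall x, g (p x) = f x.
Proof.
move=> /choice[s sP] kf.
have ff x x' : p x = p x' -> f x = f x'.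
  move=> e; apply/eqP; rewrite -subr_eq0 -linearB kf //.
  by rewrite linearB e subrr.
have [a x y|h hE] := @linear_map _ _ (f \o s).
  by rewrite /= -linearP; apply: ff; rewrite linearP !sP.
by exists h => x; rewrite hE /=; apply: ff; rewrite sP.
Qed.

(** Finitely generated projective modules, in the form of a finite dual basis.
    In this form projectivity passes by an explicit formula to restrictions of
    scalars, and maps out of the module can be defined on the basis. *)
Definition fg_projective P : Prop :=
  exists (J : finType) (u : J -> P) (f : J -> {linear P -> R^o}),
    forall x, x = \sum_j f j x *: u j.

(** The map [g] need only reach the image of [f], so lifting against an exact
    sequence needs no kernel module. *)
Lemma fg_projective_lift P M N (g : {linear M -> N}) (f : {linear P -> N}) :
    fg_projective P -> (forall x, exists y, g y = f x) ->
  exists h : {linear P -> M}, forall x, g (h x) = f x.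
Proof.
move=> [J [u [c uc]]] gf; have [v vP] := choice (fun j => gf (u j)).
have [a x y|h hE] := @linear_map P M (fun x => \sum_j c j x *: v j).
  rewrite scaler_sumr -big_split; apply: eq_bigr => j _ /=.
  by rewrite linearP scalerDl scalerA.
exists h => x; rewrite hE linear_sum [in RHS](uc x) linear_sum.
by apply: eq_bigr => j _; rewrite !linearZ vP.
Qed.

Lemma projective_fg P (J : finType) (u : J -> P) :
    projective_module P -> (forall x, exists c : J -> R, x = \sum_j c j *: u j) ->
  fg_projective P.
Proof.
move=> Pproj gen.
have [a x y|g gE] := @linear_map {ffun J -> R^o} P (fun c => \sum_j c j *: u j).
  rewrite scaler_sumr -big_split; apply: eq_bigr => j _ /=.
  by rewrite !ffunE scalerDl scalerA.
have [|h hP] := Pproj _ _ g idfun.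
  move=> x; have [c cP] := gen x; exists [ffun j => c j].
  by rewrite gE cP; apply: eq_bigr => j _; rewrite ffunE.
have /choice[f fE] j : exists f : {linear P -> R^o}, forall x, f x = h x j.
  have [a x y|f fE] := @linear_map P R^o (fun x => h x j); last by exists f.
  by rewrite linearP !ffunE.
exists J, u, f => x; rewrite -[LHS]/(idfun x) -hP gE.
by apply: eq_bigr => j _; rewrite fE.
Qed.

Section Kernel.
Variables (M N : lmodType R) (f : {linear M -> N}).
Definition in_kernel : pred M := fun x => f x == 0.
Fact in_kernel_submod : submod_closed in_kernel.
Proof.
split; first by rewrite /in_kernel unfold_in /= linear0.
by move=> a x y; rewrite !unfold_in linearP => /eqP-> /eqP->; rewrite scaler0 addr0.
Qed.
HB.instance Definition _ := GRing.isSubmodClosed.Build R M in_kernel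
  in_kernel_submod.
Record kernel := Kernel {kernel_val :> M; _ : kernel_val \in in_kernel}.
HB.instance Definition _ := [isSub for kernel_val].
HB.instance Definition _ := [Choice of kernel by <:].
HB.instance Definition _ := [SubChoice_isSubLmodule of kernel by <:].
End Kernel.

(** Finite injective dimension, one short exact sequence at a time. This form
    carries the inductions below; it is related to [inj_dim_le] by the next two
    lemmas. *)
Fixpoint finite_injective_coresolution (d : nat) (Z : lmodType R) : Prop :=
  match d with
  | 0 => forall z : Z, z = 0
  | d'.+1 => exists (I Z' : lmodType R) (i : {linear Z -> I}) (p : {linear I -> Z'}),
      [/\ injective_module I, injective i, exact_at i p, epi p
        & finite_injective_coresolution d' Z']
  end.

Lemma inj_dim_coresolution n Z : inj_dim_le Z n ->
  finite_injective_coresolution n.+1 Z.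
Proof.
case=> I [eta [d [res van]]].
have {}van i : (n.+1 <= i)%N -> forall x : I i, x = 0 by apply: van.
move: (n.+1) => m in van *; elim: m Z I eta d res van => [|m IH] Z I eta d.
  case=> _ etaI _ _ van z; apply: etaI; rewrite [LHS]van ?[RHS]van //.
case=> Iinj etaI ex0 ex van.
(* The first cosyzygy, as the kernel of the second differential. *)
pose K := kernel (d 1%N).
have [x|p pE] := @factor_through_mono _ _ K \val (d 0%N) val_inj.
  have dx : d 0%N x \in in_kernel (d 1%N).
    by rewrite unfold_in; apply/eqP/(ex 0%N); exists x.
  by exists (Kernel dx).
exists (I 0%N), K, eta, p; split => //.
- move=> y; rewrite -ex0 -pE; split => [->|]; first by rewrite linear0.
  by move=> py0; apply: val_inj; rewrite py0 linear0.
- move=> y; have /(ex 0%N)[x xP] : d 1%N (\val y) = 0 by apply/eqP/(valP y).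
  by exists x; apply: val_inj; rewrite -xP -pE.
apply: (IH _ (fun i => I i.+1) \val (fun i => d i.+1)); last by move=> i; apply: (van i.+1).
split=> [i||y|i]; [exact: Iinj | exact: val_inj | | exact: ex].
split => [dy|[x <-]]; last exact/eqP/(valP x).
have yK : y \in in_kernel (d 1%N) by rewrite unfold_in; apply/eqP.
by exists (Kernel yK).
Qed.

Lemma coresolution_inj_dim n Z :
  finite_injective_coresolution n Z -> inj_dim_le Z n.
Proof.
elim: n Z => [|n IH] Z /=.
  move=> Z0; exists (fun=> Z), idfun, (fun=> idfun); split => [|i _]; last exact: Z0.
  have ex : exact_at (@idfun Z : {linear Z -> Z}) idfun.
    by move=> y; split => _; [exists y | exact: Z0].
  split=> // _ M N g f _.
  by exists \0 => x; rewrite [RHS]Z0 [LHS]Z0.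
case=> I [Z' [i [p [Iinj iI ex pE /IH[I' [eta [d [[I'inj etaI ex0 ex'] van]]]]]]]].
pose J j := if j is j'.+1 then I' j' else I.
pose D j : {linear J j -> J j.+1} :=
  if j is j'.+1 return {linear J j -> J j.+1} then d j' else eta \o p.
exists J, i, D; split; last by case=> // j; rewrite ltnS => /van.
split=> //; [by case | |].
- move=> y; rewrite -ex /=; split => [|->]; last by rewrite linear0.
  by move=> e; apply: etaI; rewrite e linear0.
case=> [|j] y /=; last exact: ex'.
rewrite ex0; split=> [[x <-]|[x <-]]; last by exists (p x).
by have [w <-] := pE x; exists w.
Qed.

Lemma coresolution_iso n Y Z (f : {linear Y -> Z}) : bijective f ->
  finite_injective_coresolution n Z -> finite_injective_coresolution n Y.
Proof.
case: n => [|n] fB /=; first by move=> Z0 y; apply: (bij_inj fB); rewrite [LHS]Z0 linear0.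
case=> I [Z' [i [p [Iinj iI ex pE cor]]]]; exists I, Z', (i \o f), p.
split=> //; first exact: inj_comp iI (bij_inj fB).
move=> y; rewrite ex; split=> [[x <-]|[x <-]]; last by exists (f x).
by have [g _ gK] := fB; exists (g x); rewrite /= gK.
Qed.

Lemma injective_retract I X (s : {linear I -> X}) (r : {linear X -> I}) :
  injective_module X -> cancel s r -> injective_module I.
Proof.
move=> Xinj sK M N g f gI; have [h hP] := Xinj _ _ g (s \o f) gI.
by exists (r \o h) => x; rewrite /= hP /= sK.
Qed.

End Modules.

(** * Vector spaces are injective *)

(** Zorn's lemma provides a subspace C that is maximal among those meeting the
    image of [g] trivially; it is a complement of the image, and the extension
    vanishes on it. *)
Lemma vector_space_injective (k : fieldType) (V : lmodType k) : injective_module V.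
Proof.
move=> U W g f gI.
pose closed (C : set W) := forall a x y, C x -> C y -> C (a *: x + y).
pose good (C : set W) := closed C /\ forall u, C (g u) -> u = 0.
have [F Fgood Ftot|C [[Ccl Cg] Cmax]] := @Zorn_bigcup W good.
  split=> [a x y [X FX Xx] [Y FY Yy]|u [X FX]]; last by case: (Fgood _ FX) => _; apply.
  have [XY|YX] := Ftot _ _ FX FY.
    by exists Y => //; apply: (Fgood _ FY).1 => //; apply: XY.
  by exists X => //; apply: (Fgood _ FX).1 => //; apply: YX.
(* The closure condition does not exclude the empty set, hence [C0]. *)
pose C0 y := C y \/ y = 0.
have C0cl a x y : C0 x -> C0 y -> C0 (a *: x + y).
  move=> [Cx|->] [Cy|->]; rewrite ?scaler0 ?addr0 ?add0r; try by [left|right].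
    by left; apply: Ccl.
  left; rewrite (_ : a *: x = (a - 1) *: x + x); first exact: Ccl.
  by rewrite scalerBl scale1r subrK.
have dec w : exists uc : U * W, C0 uc.2 /\ w = g uc.1 + uc.2.
  apply: contrapT => nw.
  pose C' := [set z | exists a y, C0 y /\ z = a *: w + y]%classic.
  apply: (Cmax C').
    split=> [y Cy|C'C].
      by exists 0, y; rewrite scale0r add0r; split=> //; left.
    have Cw : C w by apply: C'C; exists 1, 0; rewrite scale1r addr0; split=> //; right.
    by apply: nw; exists (0, w); rewrite linear0 add0r; split=> //; left.
  split=> [a _ _ [b [x [Cx ->]]] [c [y [Cy ->]]]|u [a [y [Cy guE]]]].
    exists (a * b + c), (a *: x + y); split; first exact: C0cl.
    by rewrite scalerDr scalerA scalerDl addrACA.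
  have [a0|a0] := eqVneq a 0.
    move: guE; rewrite a0 scale0r add0r; case: Cy => [Cy guE|-> gu0].
      by apply: Cg; rewrite guE.
    by apply: gI; rewrite linear0.
  case: nw; exists (a^-1 *: u, - a^-1 *: y); split=> /=.
    by rewrite -[_ *: y]addr0; apply: C0cl => //; right.
  by rewrite linearZ_LR guE scalerDr scalerA mulVf // scale1r scaleNr addrK.
have [uc /all_and2[cC cE]] := choice dec.
have uniq u u' c c' : C0 c -> C0 c' -> g u + c = g u' + c' -> u = u'.
  move=> Cc Cc' e; apply/eqP; rewrite -subr_eq0; apply/eqP.
  have gE : g (u - u') = -1 *: c + c'.
    by rewrite linearB scaleN1r -[g u](addrK c) e addrAC [g u' + c']addrC addrK addrC.
  have [|] := C0cl (-1) c c' Cc Cc'; rewrite -gE; first exact: Cg.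
  by move=> g0; apply: gI; rewrite g0 linear0.
have [a x y|h hE] := @linear_map _ W V (fun w => f (uc w).1).
  rewrite -linearP; congr (f _).
  apply: (uniq _ _ (uc (a *: x + y)).2 (a *: (uc x).2 + (uc y).2)) => //.
    exact: C0cl.
  by rewrite -cE linearP addrACA -scalerDr -!cE.
exists h => u; rewrite hE; congr (f _).
by apply: (uniq _ _ (uc (g u)).2 0); [|right|rewrite -cE addr0].
Qed.

(** * Finite dimensional modules over a finite dimensional algebra *)

Section FiniteDimension.
Variables (k : fieldType) (E : falgType k).
Implicit Types M N P : lmodType E.

(** Asking for an embedding rather than a basis makes heredity to submodules
    immediate. *)
Definition finite_dimensional M : Prop :=
  exists (V : vectType k) (g : M -> V), injective g /\
    forall a x y, g (a%:A *: x + y) = a *: g x + g y.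

Lemma finite_dimensional_sub M N (i : {linear N -> M}) :
  injective i -> finite_dimensional M -> finite_dimensional N.
Proof.
move=> iI [V [g [gI gL]]]; exists V, (g \o i); split; first exact: inj_comp.
by move=> a x y; rewrite /= linearP gL.
Qed.

(** A list of elements whose images span a subspace of maximal dimension
    generates the module. *)
Lemma finite_dimensional_generated M : finite_dimensional M ->
  exists (J : finType) (u : J -> M),
    forall x, exists c : J -> E, x = \sum_j c j *: u j.
Proof.
case=> V [g [gI gL]].
have [s sP] : exists s : seq M, forall x, g x \in <<map g s>>%VS.
  apply: contrapT => ns.
  have big n : exists s : seq M, (n <= \dim <<map g s>>)%N.
    elim: n => [|n [s ns']]; first by exists [::].
    have [x /negP gx] : exists x, ~ g x \in <<map g s>>%VS.
      by apply/existsNP => sP; apply: ns; exists s.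
    exists (x :: s); apply: leq_ltn_trans ns' _; rewrite /= span_cons.
    rewrite ltn_neqAle (dimv_leqif_eq (addvSr _ _)) dimvS ?addvSr // andbT.
    apply: contra gx => /eqP->; exact: (subvP (addvSl _ _)) (memv_line _).
  have [s] := big (\dim {:V}).+1.
  by rewrite ltnNge dimvS ?subvf.
exists 'I_(size (map g s)), (fun j : 'I__ => s`_j) => x.
exists (fun j => (coord (in_tuple (map g s)) j (g x))%:A); apply: gI.
have g0 : g 0 = 0 by have := gL (-1) 0 0; rewrite scaler0 addr0 scaleN1r addNr.
have gD : {morph g : y z / y + z}.
  by move=> y z; have := gL 1 y z; rewrite !scale1r.
rewrite (big_morph g gD g0) [LHS](coord_span (X := in_tuple _) (sP x)).
apply: eq_bigr => j _; rewrite -[_%:A *: _]addr0 gL g0 addr0 (nth_map 0) //.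
by rewrite -(size_map g) ltn_ord.
Qed.

Lemma fg_projective_finite_dimensional P :
  fg_projective P -> finite_dimensional P.
Proof.
case=> J [u [f fu]]; exists {ffun J -> E}, (fun x => [ffun j => f j x]); split.
  move=> x y /ffunP xy; rewrite (fu x) (fu y); apply: eq_bigr => j _.
  by have := xy j; rewrite !ffunE => ->.
move=> a x y; apply/ffunP => j; rewrite !ffunE linearP /=.
by congr (_ + _); apply: mulr_algl.
Qed.

(** The projective cover is finitely generated: lifts of finitely many
    generators of [M] generate a submodule of [P] that still maps onto [M],
    and the cover is essential. *)
Lemma syzygy_finite_dimensional M N : finite_dimensional M -> is_syzygy M N ->
  exists (P : lmodType E) (p : {linear P -> M}) (i : {linear N -> P}),
    [/\ fg_projective P, epi p, injective i & exact_at i p].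
Proof.
move=> /finite_dimensional_generated[J [u gen]] [P [p [i [[Pproj [pE ess]] iI ex]]]].
exists P, p, i; split=> //.
have [v vP] := choice (fun j => pE (u j)).
have [a x y|g gE] := @linear_map _ {ffun J -> E^o} P (fun c => \sum_j c j *: v j).
  rewrite scaler_sumr -big_split; apply: eq_bigr => j _ /=.
  by rewrite !ffunE scalerDl scalerA.
apply: (projective_fg (u := v)) => // x.
have [y|c cE] := ess _ g _ x; last by exists c; rewrite -cE gE.
have [c ->] := gen y; exists [ffun j => c j]; rewrite gE linear_sum.
by apply: eq_bigr => j _; rewrite linearZ_LR vP ffunE.
Qed.

End FiniteDimension.

(** * Restriction of scalars, and modules over an enveloping algebra *)

Definition restrict (R R' : nzRingType) (f : {rmorphism R -> R'})
  (M : lmodType R') : Type := M.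

Section Restriction.
Variables (R R' : nzRingType) (f : {rmorphism R -> R'}).
Implicit Types M N : lmodType R'.

HB.instance Definition _ M := GRing.Zmodule.on (restrict f M).

Definition restrict_scale M (a : R) (x : restrict f M) : restrict f M :=
  f a *: (x : M).
Fact restrict_scaleA M a b (x : restrict f M) :
  restrict_scale a (restrict_scale b x) = restrict_scale (a * b) x.
Proof. by rewrite /restrict_scale scalerA rmorphM. Qed.
Fact restrict_scale1 M : left_id 1 (@restrict_scale M).
Proof. by move=> x; rewrite /restrict_scale rmorph1 scale1r. Qed.
Fact restrict_scaleDr M : right_distributive (@restrict_scale M) +%R.
Proof. by move=> a x y; rewrite /restrict_scale scalerDr. Qed.
Fact restrict_scaleDl M (x : restrict f M) :
  {morph (@restrict_scale M)^~ x : a b / a + b}.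
Proof. by move=> a b; rewrite /restrict_scale rmorphD scalerDl. Qed.
HB.instance Definition _ M := GRing.Zmodule_isLmodule.Build R (restrict f M)
  (@restrict_scaleA M) (@restrict_scale1 M) (@restrict_scaleDr M)
  (@restrict_scaleDl M).

Definition restrict_map M N (g : {linear M -> N}) (x : restrict f M) :
  restrict f N := g x.
Fact restrict_map_linear M N (g : {linear M -> N}) : linear (restrict_map g).
Proof. by move=> a x y; rewrite /restrict_map linearP. Qed.
HB.instance Definition _ M N (g : {linear M -> N}) :=
  GRing.isLinear.Build R (restrict f M) (restrict f N) *:%R
    (restrict_map g) (restrict_map_linear g).

End Restriction.

(** [E] is the tensor product over k of [A] and [B], presented by commuting
    embeddings of the factors and by coordinates in the products of basis
    vectors, and [op] is an anti-isomorphism from [A] to [B]. The setting is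
    abstract because it is used twice, with the factors in either order; the
    anti-isomorphism stands in for taking [B] to be the converse of [A], since
    the converse of the converse of an algebra is not convertible to it. *)
Record enveloping_setting (k : fieldType) (A B E : falgType k) := EnvelopingSetting {
  inA : {lrmorphism A -> E};
  inB : {lrmorphism B -> E};
  tcoef : 'I_(dim A) -> 'I_(dim B) -> E -> k;
  op : {linear A -> B};
  op_inv : B -> A;
  inAB_comm : forall a b, inA a * inB b = inB b * inA a;
  tcoefD : forall i j, {morph tcoef i j : x y / x + y};
  tcoef_tens : forall i j a b, tcoef i j (inA a * inB b) = v2r a 0 i * v2r b 0 j;
  tcoef_sum : forall e, e = \sum_i \sum_j tcoef i j e *: (inA (vb i) * inB (vb j));
  opM : forall x y, op (x * y) = op y * op x;
  opK : cancel op op_inv;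
  op_invK : cancel op_inv op }.

(** The bimodule obtained by tensoring the [A]-module [I] with the regular
    [B]-module: the entry at j is the coefficient of the basis vector [vb j] of
    [B]. The setting is a parameter because the action of [E] depends on it. *)
Definition tensorB (k : fieldType) (A B E : falgType k)
  (X : enveloping_setting A B E) (I : lmodType A) : Type := {ffun 'I_(dim B) -> I}.

Section Setting.
Variables (k : fieldType) (A B E : falgType k) (X : enveloping_setting A B E).
Local Notation iA := (inA X).
Local Notation iB := (inB X).

(** Additivity suffices, since scalars of k can be moved into the first
    factor. *)
Lemma additive_tens_ext (V : zmodType) (f g : E -> V) :
    {morph f : x y / x + y} -> {morph g : x y / x + y} ->
    (forall a b, f (iA a * iB b) = g (iA a * iB b)) -> f =1 g.
Proof.
move=> fD gD fg e.
have h0 (h : E -> V) : {morph h : x y / x + y} -> h 0 = 0.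
  by move=> hD; apply: (addIr (h 0)); rewrite -hD !add0r.
rewrite (tcoef_sum X e) !(big_morph f fD (h0 f fD), big_morph g gD (h0 g gD)).
apply: eq_bigr => i _.
rewrite !(big_morph f fD (h0 f fD), big_morph g gD (h0 g gD)).
by apply: eq_bigr => j _; rewrite scalerAl -linearZ fg.
Qed.

Lemma tensM a b a' b' :
  (iA a * iB b) * (iA a' * iB b') = iA (a * a') * iB (b * b').
Proof. by rewrite !rmorphM -!mulrA; congr (_ * _); rewrite !mulrA inAB_comm. Qed.

Lemma bimodule_linear_map (M N : lmodType E) (f : M -> N) : {morph f : x y / x + y} ->
    (forall a x, f (iA a *: x) = iA a *: f x) ->
    (forall b x, f (iB b *: x) = iB b *: f x) ->
  exists g : {linear M -> N}, g =1 f.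
Proof.
move=> fD fA fB; apply: linear_map => e x y; rewrite fD; congr (_ + _).
move: e; apply: additive_tens_ext => [e e'|e e'|a b]; rewrite ?scalerDl ?fD //.
by rewrite -!scalerA fA fB.
Qed.

Lemma scale_scalar_comm (R : falgType k) (I : lmodType R) c (a : R) (y : I) :
  a *: (c%:A *: y) = c%:A *: (a *: y).
Proof. by rewrite !scalerA mulr_algl mulr_algr. Qed.

Section TensorB.
Variable I : lmodType A.
Local Notation tensorB := (tensorB X I).
HB.instance Definition _ := GRing.Zmodule.on tensorB.

(** The coefficients form the matrix of left multiplication by b. *)
Definition actB (b : B) (y : tensorB) i : I :=
  \sum_j (v2r (b * vb j) 0 i)%:A *: y j.

Definition tensorB_scale (e : E) (y : tensorB) : tensorB :=
  [ffun i => \sum_p \sum_q (tcoef X p q e *: vb p) *: actB (vb q) y i].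

Lemma actB_linear b y i : actB b y i = \sum_q (v2r b 0 q)%:A *: actB (vb q) y i.
Proof.
rewrite /actB; under [RHS]eq_bigr do rewrite scaler_sumr.
rewrite exchange_big; apply: eq_bigr => j _ /=.
under [RHS]eq_bigr do rewrite scalerA -scalerAl mul1r scalerA.
rewrite -scaler_suml -scaler_suml; congr (_%:A *: _).
rewrite {1}[b]vb_sum mulr_suml linear_sum /= summxE.
by apply: eq_bigr => q _; rewrite -scalerAl linearZ mxE.
Qed.

Lemma actBM b b' y i : actB b [ffun j => actB b' y j] i = actB (b * b') y i.
Proof.
rewrite /actB; under [LHS]eq_bigr do rewrite ffunE scaler_sumr.
rewrite exchange_big; apply: eq_bigr => j _ /=.
under [LHS]eq_bigr do rewrite scalerA -scalerAl mul1r scalerA.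
rewrite -scaler_suml -scaler_suml; congr (_%:A *: _).
rewrite -mulrA [b' * _ in RHS]vb_sum mulr_sumr linear_sum /= summxE.
by apply: eq_bigr => q _; rewrite -scalerAr linearZ mxE mulrC.
Qed.

Lemma tensorB_scale_tens a b y i : tensorB_scale (iA a * iB b) y i = a *: actB b y i.
Proof.
rewrite ffunE [in RHS](vb_sum a) scaler_suml; apply: eq_bigr => p _.
rewrite actB_linear scaler_sumr; apply: eq_bigr => q _.
by rewrite tcoef_tens scalerA mulr_algr scalerA mulrC.
Qed.

Fact tensorB_scaleDl y : {morph tensorB_scale^~ y : e e' / e + e'}.
Proof.
move=> e e'; apply/ffunP => i; rewrite !ffunE -big_split; apply: eq_bigr => p _ /=.
by rewrite -big_split; apply: eq_bigr => q _; rewrite tcoefD !scalerDl.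
Qed.

Fact tensorB_scaleDr : right_distributive tensorB_scale +%R.
Proof.
move=> e y y'; apply/ffunP => i; rewrite !ffunE -big_split; apply: eq_bigr => p _ /=.
rewrite -big_split; apply: eq_bigr => q _ /=; rewrite -scalerDr -big_split.
by congr (_ *: _); apply: eq_bigr => j _; rewrite ffunE scalerDr.
Qed.

Fact tensorB_scale1 : left_id 1 tensorB_scale.
Proof.
move=> y; apply/ffunP => i.
rewrite -[1]mulr1 -{1}(rmorph1 iA) -(rmorph1 iB) tensorB_scale_tens scale1r.
rewrite /actB (bigD1 i) //= mul1r r2vK mxE !eqxx scale1r scale1r big1 ?addr0 //.
move=> j ji; rewrite mul1r r2vK mxE eqxx /= eq_sym (negPf ji) scale0r.
exact: scale0r.
Qed.

Fact tensorB_scaleA e e' y :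
  tensorB_scale e (tensorB_scale e' y) = tensorB_scale (e * e') y.
Proof.
move: e; apply: additive_tens_ext => [e1 e2|e1 e2|a b].
- exact: tensorB_scaleDl.
- by rewrite mulrDl tensorB_scaleDl.
move: e'; apply: additive_tens_ext => [e1 e2|e1 e2|a' b'].
- by rewrite tensorB_scaleDl tensorB_scaleDr.
- by rewrite mulrDr tensorB_scaleDl.
apply/ffunP => i; rewrite tensM !tensorB_scale_tens -actBM -scalerA; congr (_ *: _).
rewrite /actB scaler_sumr; apply: eq_bigr => j _.
by rewrite tensorB_scale_tens scale_scalar_comm ffunE.
Qed.

HB.instance Definition _ := GRing.Zmodule_isLmodule.Build E tensorB
  tensorB_scaleA tensorB_scale1 tensorB_scaleDr tensorB_scaleDl.

Lemma tensorB_scaleE a b (y : tensorB) i : ((iA a * iB b) *: y) i = a *: actB b y i.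
Proof. exact: tensorB_scale_tens. Qed.

Lemma actB1 (y : tensorB) i : actB 1 y i = y i.
Proof.
by rewrite -[LHS]scale1r -tensorB_scaleE !rmorph1 mulr1 scale1r.
Qed.

Lemma tensorB_scale_inA a (y : tensorB) i : (iA a *: y) i = a *: y i.
Proof. by rewrite -[iA a]mulr1 -(rmorph1 iB) tensorB_scaleE actB1. Qed.

Lemma tensorB_scale_inB b (y : tensorB) i : (iB b *: y) i = actB b y i.
Proof. by rewrite -[iB b]mul1r -(rmorph1 iA) tensorB_scaleE scale1r. Qed.

End TensorB.

End Setting.

(** * Relative injectivity of tensored injectives *)

Lemma v2rZ (k : fieldType) (V : vectType k) c (v : V) i :
  v2r (c *: v) 0 i = c * v2r v 0 i.
Proof. by rewrite linearZ mxE. Qed.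

Lemma v2r_vb (k : fieldType) (V : vectType k) (i j : 'I_(dim V)) :
  v2r (vb j) 0 i = (i == j)%:R.
Proof. by rewrite r2vK mxE. Qed.

Section Coinduced.
Variables (k : fieldType) (R : falgType k) (I : lmodType R).

(** The module of k-linear maps from [R] to [I], where a acts by
    precomposition with right multiplication by a; a map is given by its values
    on the basis of [R]. *)
Definition coinduced : Type := {ffun 'I_(dim R) -> I}.
HB.instance Definition _ := GRing.Zmodule.on coinduced.

Definition coinduced_scale (a : R) (u : coinduced) : coinduced :=
  [ffun i => \sum_l (v2r (vb i * a) 0 l)%:A *: u l].

Fact coinduced_scaleA a b u :
  coinduced_scale a (coinduced_scale b u) = coinduced_scale (a * b) u.
Proof.
apply/ffunP => i; rewrite !ffunE; under eq_bigr do rewrite ffunE scaler_sumr.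
rewrite exchange_big; apply: eq_bigr => l _ /=.
under eq_bigr do rewrite scalerA -scalerAl mul1r scalerA.
rewrite -scaler_suml -scaler_suml; congr (_%:A *: _).
rewrite mulrA [vb i * a in RHS]vb_sum mulr_suml linear_sum /= summxE.
by apply: eq_bigr => q _; rewrite -scalerAl linearZ mxE.
Qed.

Fact coinduced_scaleZ c u i : coinduced_scale c%:A u i = c%:A *: u i.
Proof.
rewrite ffunE (bigD1 i) //= mulr_algr v2rZ v2r_vb eqxx mulr1 big1 ?addr0 // => j ji.
by rewrite v2rZ v2r_vb (negPf ji) mulr0 scale0r scale0r.
Qed.

Fact coinduced_scale1 : left_id 1 coinduced_scale.
Proof. by move=> u; apply/ffunP => i; rewrite -[1]scale1r coinduced_scaleZ !scale1r. Qed.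

Fact coinduced_scaleDr : right_distributive coinduced_scale +%R.
Proof.
move=> a u v; apply/ffunP => i; rewrite !ffunE -big_split.
by apply: eq_bigr => l _; rewrite ffunE scalerDr.
Qed.

Fact coinduced_scaleDl u : {morph coinduced_scale^~ u : a b / a + b}.
Proof.
move=> a b; apply/ffunP => i; rewrite !ffunE -big_split.
by apply: eq_bigr => l _; rewrite mulrDr linearD mxE !scalerDl.
Qed.

HB.instance Definition _ := GRing.Zmodule_isLmodule.Build R coinduced
  coinduced_scaleA coinduced_scale1 coinduced_scaleDr coinduced_scaleDl.

Lemma coinduced_scaleE a (u : coinduced) i :
  (a *: u) i = \sum_l (v2r (vb i * a) 0 l)%:A *: u l.
Proof. exact: ffunE. Qed.

Lemma scale_vb_sum (a : R) (y : I) : a *: y = \sum_l (v2r a 0 l)%:A *: (vb l *: y).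
Proof.
rewrite {1}[a]vb_sum scaler_suml; apply: eq_bigr => l _.
by rewrite scalerA mulr_algl.
Qed.

(** [I] embeds in its coinduced module by sending y to the map a |-> a y, and
    the embedding splits when [I] is injective. *)
Lemma injective_coinduced_retract : injective_module I ->
  exists rho : {linear coinduced -> I}, forall y, rho [ffun i => vb i *: y] = y.
Proof.
move=> Iinj; pose c y : coinduced := [ffun i => vb i *: y].
have [a x y|g gE] := @linear_map _ I coinduced c.
  apply/ffunP => i; rewrite ffunE scalerDr scalerA [in RHS]ffunE coinduced_scaleE.
  rewrite !ffunE scale_vb_sum; congr (_ + _); apply: eq_bigr => l _.
  by rewrite ffunE.
have [x y|rho rhoP] := Iinj _ _ g idfun; last by exists rho => y; rewrite -/(c y) -gE.
rewrite !gE => /ffunP xy; rewrite -[x]scale1r -[y]scale1r !scale_vb_sum.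
by apply: eq_bigr => l _; have := xy l; rewrite !ffunE => ->.
Qed.

End Coinduced.

Section RelativeInjectivity.
Variables (k : fieldType) (A B E : falgType k) (X : enveloping_setting A B E).
Local Notation iA := (inA X).
Local Notation iB := (inB X).

(** If [I] were coinduced from a vector space V, bimodule maps into
    [tensorB I] would be the same as [B]-linear maps into V tensor [B], and
    these extend by composition with the retraction [r]. An injective [I] is a
    retract of a coinduced module. *)
Lemma tensorB_relative_injective (I : lmodType A) (M N : lmodType E)
    (i : {linear N -> M}) (r : {linear restrict iB M -> restrict iB N})
    (f : {linear N -> tensorB X I}) :
    injective_module I -> (forall y, r (i y) = y) ->
  exists g : {linear M -> tensorB X I}, forall y, g (i y) = f y.
Proof.
move=> /injective_coinduced_retract[rho rhoP] rK.
have central c (x : M) : iA c%:A *: x = iB c%:A *: x.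
  by rewrite !linearZ !rmorph1.
have frB b x j : f (r (iB b *: x)) j = actB b (f (r x)) j.
  by rewrite -tensorB_scale_inB -linearZ_LR; congr (f _ _); apply: (linearZ_LR r).
have frA0 c x j : f (r (iA c%:A *: x)) j = c%:A *: f (r x) j.
  by rewrite central frB -tensorB_scale_inB -tensorB_scale_inA !linearZ !rmorph1.
pose u x j : coinduced I := [ffun p => f (r (iA (vb p) *: x)) j].
have frD x y j : f (r (x + y)) j = f (r x) j + f (r y) j.
  rewrite (_ : r (x + y) = (r x : N) + r y); last exact: (linearD r).
  by rewrite linearD ffunE.
have fr0 j : f (r 0) j = 0 by apply: (addIr (f (r 0) j)); rewrite -frD !add0r.
have fr_sum (J : Type) (s : seq J) (F : J -> M) j :
    f (r (\sum_(l <- s) F l)) j = \sum_(l <- s) f (r (F l)) j.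
  by apply: (big_morph (fun x => f (r x) j)) => // x y; apply: frD.
(* The B-linear extension [f \o r] of [f], made A-linear by coinduction and
   then pushed into [I] by [rho]. *)
have [x y|a x|b x|g gE] := @bimodule_linear_map _ _ _ _ X M (tensorB X I)
    (fun x => [ffun j => rho (u x j)]).
- apply/ffunP => j; rewrite !ffunE -linearD; congr (rho _).
  by apply/ffunP => p; rewrite !ffunE scalerDr frD.
- apply/ffunP => j; rewrite tensorB_scale_inA !ffunE -linearZ_LR; congr (rho _).
  apply/ffunP => p; rewrite coinduced_scaleE ffunE scalerA -rmorphM.
  rewrite {1}[vb p * a]vb_sum rmorph_sum scaler_suml fr_sum.
  by apply: eq_bigr => l _; rewrite ffunE -[_ *: vb l]mulr_algl rmorphM -scalerA frA0.
- apply/ffunP => j; rewrite tensorB_scale_inB !ffunE.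
  rewrite -[RHS]/(actB b _ j) /actB; under [RHS]eq_bigr do rewrite ffunE -linearZ_LR.
  rewrite -linear_sum; congr (rho _); apply/ffunP => p.
  rewrite ffunE scalerA inAB_comm -scalerA frB sum_ffunE; apply: eq_bigr => l _.
  by rewrite [RHS]coinduced_scaleZ ffunE.
exists g => y; rewrite gE; apply/ffunP => j; rewrite ffunE -[RHS]rhoP.
congr (rho _); apply/ffunP => p; rewrite !ffunE -tensorB_scale_inA.
by rewrite -linearZ_LR -linearZ_LR rK.
Qed.

Section TensorMap.
Variables (I J : lmodType A) (g : {linear I -> J}).
Definition tensorB_map (y : tensorB X I) : tensorB X J := [ffun i => g (y i)].
Fact tensorB_map_linear : linear tensorB_map.
Proof.
have mD : {morph tensorB_map : x y / x + y}.
  by move=> x y; apply/ffunP => i; rewrite !ffunE linearD.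
have [||h hE] := bimodule_linear_map (X := X) mD; last by move=> e x y; rewrite -!hE linearP.
- by move=> a x; apply/ffunP => i; rewrite ffunE !tensorB_scale_inA linearZ ffunE.
move=> b x; apply/ffunP => i; rewrite ffunE !tensorB_scale_inB /actB linear_sum.
by apply: eq_bigr => j _; rewrite linearZ ffunE.
Qed.
HB.instance Definition _ := GRing.isLinear.Build E (tensorB X I) (tensorB X J) *:%R
  tensorB_map tensorB_map_linear.
End TensorMap.

(** The multiplication map from [tensorB A] onto the free module [E] splits; it
    is in fact an isomorphism. *)
Lemma tensorB_regular_retract :
  exists (s : {linear E^o -> tensorB X A^o}) (r : {linear tensorB X A^o -> E^o}),
    cancel s r.
Proof.
have [x y|a x|b x|r rE] := @bimodule_linear_map _ _ _ _ X (tensorB X A^o) E^o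
    (fun y => \sum_j iA (y j) * iB (vb j)).
- by rewrite -big_split; apply: eq_bigr => j _; rewrite ffunE rmorphD mulrDl.
- rewrite scaler_sumr; apply: eq_bigr => j _; rewrite tensorB_scale_inA rmorphM.
  by rewrite -mulrA.
- rewrite scaler_sumr; under eq_bigr do rewrite tensorB_scale_inB rmorph_sum mulr_suml.
  rewrite exchange_big; apply: eq_bigr => j _.
  rewrite -[RHS]/(iB b * (iA (x j) * iB (vb j))) mulrA -inAB_comm -mulrA.
  have -> : iB b * iB (vb j) = \sum_l v2r (b * vb j) 0 l *: iB (vb l).
    rewrite -rmorphM {1}[b * _]vb_sum rmorph_sum.
    by apply: eq_bigr => l _; apply: (linearZ_LR iB).
  rewrite mulr_sumr; apply: eq_bigr => l _ /=.
  rewrite -scalerAr scalerAl; congr (_ * _); rewrite -(linearZ_LR iA).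
  by congr (iA _); apply: mulr_algl.
(* The coordinates of 1, a preimage of 1 under the multiplication map. *)
pose y0 : tensorB X A^o := [ffun j => \sum_i tcoef X i j 1 *: (vb i : A)].
have [a x y|s sE] := @linear_map _ E^o (tensorB X A^o) (fun e => e *: y0).
  by rewrite scalerDl -scalerA.
exists s, r => e; rewrite sE linearZ_LR -[RHS]mulr1; congr (e *: _).
rewrite rE [RHS](tcoef_sum X) exchange_big; apply: eq_bigr => j _.
rewrite ffunE rmorph_sum mulr_suml; apply: eq_bigr => i _.
by rewrite scalerAl; congr (_ * _); apply: (linearZ_LR iA).
Qed.

End RelativeInjectivity.

(** * Vanishing of Ext into projective bimodules *)

Section Setting.
Variables (k : fieldType) (A B E : falgType k) (X : enveloping_setting A B E).
Local Notation iA := (inA X).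
Local Notation iB := (inB X).
Implicit Types K L M N P Q : lmodType E.

(** A syzygy sequence as it arises below: besides being exact it splits over
    [B], because the syzygies of [A] as a bimodule are projective over [B]. *)
Definition split_presentation M N P (p : {linear P -> M}) (i : {linear N -> P}) :=
  [/\ fg_projective P, epi p, injective i, exact_at i p
    & exists r : {linear restrict iB P -> restrict iB N}, forall y, r (i y) = y].

(** [N] is an n-th syzygy of [M], where the presentations may be any split
    presentations and not only projective covers. This freedom allows syzygies
    of syzygies to be composed and periods to be iterated. *)
Fixpoint syzygy_chain (n : nat) M N : Prop :=
  match n with
  | 0 => linear_iso M N
  | n'.+1 => exists (L P : lmodType E) (p : {linear P -> L}) (i : {linear N -> P}),
      syzygy_chain n' M L /\ split_presentation p i
  end.

(** Vanishing of Ext^1(M, [tensorB Z]) when [Z] has injective dimension less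
    than d and M is a d-th syzygy. Dimension shifting on both sides: extend into
    [tensorB I], and correct the extension g0 by a map that factors through [M]
    so that it lands in [tensorB Z]. *)
Lemma extend_to_tensorB d (Z : lmodType A) K M N P (p : {linear P -> M})
    (i : {linear N -> P}) (f : {linear N -> tensorB X Z}) :
    finite_injective_coresolution d Z -> syzygy_chain d K M ->
    split_presentation p i ->
  exists g : {linear P -> tensorB X Z}, forall y, g (i y) = f y.
Proof.
elim: d Z K M N P p i f => [|d IH] Z K M N P p i f /=.
  move=> Z0 _ _; exists \0 => y; apply/ffunP => j.
  by rewrite [LHS]Z0 [RHS]Z0.
case=> I [Z' [e [pi [Iinj eI ex piE cor]]]].
case=> L [Q [q [i1 [chain pres1]]]] [_ pE _ ex_p [r rK]].
pose Te := @tensorB_map _ _ _ _ X _ _ e : {linear _ -> _}.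
pose Tpi := @tensorB_map _ _ _ _ X _ _ pi : {linear _ -> _}.
have TeI : injective Te.
  move=> y y' /ffunP yy'; apply/ffunP => j; apply: eI.
  by have := yy' j; rewrite !ffunE.
have Tex (y : tensorB X I) : (exists w, Te w = y) <-> Tpi y = 0.
  split=> [[w <-]|/ffunP y0].
    by apply/ffunP => j; rewrite !ffunE; apply/ex; exists (w j).
  have /choice[w wE] j : exists z, e z = y j.
    by apply/ex; have := y0 j; rewrite !ffunE.
  by exists [ffun j => w j]; apply/ffunP => j; rewrite !ffunE.
have TpiE y : exists x, Tpi x = y.
  have /choice[w wE] j : exists z, pi z = y j by apply: piE.
  by exists [ffun j => w j]; apply/ffunP => j; rewrite !ffunE.
have [g0 g0E] := tensorB_relative_injective (Te \o f) Iinj rK.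
have [|f1 f1E] := factor_through_epi (f := Tpi \o g0) pE.
  move=> x /ex_p[y <-] /=; rewrite g0E; apply/Tex; by exists (f y).
have [g1 g1E] := IH _ _ _ _ _ _ _ f1 cor chain pres1.
have [Qproj _ _ _ _] := pres1.
have [|h hE] := @fg_projective_lift _ Q _ _ Tpi g1 Qproj; first by move=> x; apply: TpiE.
have [x|g gE] := @factor_through_mono _ _ _ _ Te (g0 \- (h \o i1 \o p)) TeI.
  by apply/Tex; rewrite linearB /= hE g1E f1E subrr.
exists g => y; apply: TeI; rewrite gE /= g0E.
have -> : p (i y) = 0 by apply/ex_p; exists y.
by rewrite !linear0 addr0.
Qed.

(** The dual basis reduces the target to [E], which is a retract of
    [tensorB A]. *)
Lemma extend_to_projective d K M N P (p : {linear P -> M})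
    (i : {linear N -> P}) P' (f : {linear N -> P'}) :
    finite_injective_coresolution d (A^o : lmodType A) -> syzygy_chain d K M ->
    split_presentation p i -> fg_projective P' ->
  exists g : {linear P -> P'}, forall y, g (i y) = f y.
Proof.
move=> cor chain pres [J [u [c cE]]].
have [s [r sK]] := tensorB_regular_retract X.
have /choice[g gE] j := extend_to_tensorB (s \o c j \o f) cor chain pres.
have [a x y|h hE] := @linear_map _ P P' (fun x => \sum_j r (g j x) *: u j).
  rewrite scaler_sumr -big_split; apply: eq_bigr => j _ /=.
  by rewrite !linearP scalerDl scalerA.
exists h => y; rewrite hE [RHS]cE; apply: eq_bigr => j _.
by rewrite gE /= sK.
Qed.

End Setting.

(** * The dual of a bimodule *)

(** The [B]-linear maps from a bimodule to the regular [B]-module. The action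
    of [A] on the bimodule makes them a [B]-module again, through the
    anti-isomorphism of the setting. *)
Record dual (k : fieldType) (A B E : falgType k) (X : enveloping_setting A B E)
  (M : lmodType E) := Dual {
    dual_fun :> restrict (inB X) M -> B^o;
    dual_funP : linear dual_fun }.

Section Dual.
Variables (k : fieldType) (A B E : falgType k) (X : enveloping_setting A B E).
Local Notation iA := (inA X).
Local Notation iB := (inB X).
Local Notation op' := (op_inv X).
Implicit Types M N P : lmodType E.

Lemma op_invM x y : op' (x * y) = op' y * op' x.
Proof. by apply: (can_inj (opK X)); rewrite opM !op_invK. Qed.
Lemma op_inv_linear : linear op'.
Proof. by move=> a x y; apply: (can_inj (opK X)); rewrite linearP !op_invK. Qed.
Lemma op_inv1 : op' 1 = 1.
Proof.
by rewrite -[LHS]mulr1 -[X in _ * X = _](opK X) -op_invM mulr1 opK.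
Qed.
Lemma op_inv_scalar a : op' a%:A = a%:A.
Proof.
apply: (can_inj (opK X)); rewrite op_invK linearZ_LR.
by congr (_ *: _); rewrite -[in RHS]op_inv1 op_invK.
Qed.

Section Module.
Variable M : lmodType E.
Local Notation D := (dual X M).

HB.instance Definition _ := gen_eqMixin D.
HB.instance Definition _ := gen_choiceMixin D.
HB.instance Definition _ (f : D) :=
  GRing.isLinear.Build B (restrict iB M) B^o *:%R f (dual_funP f).

Lemma dual_ext (f g : D) : f =1 g -> f = g.
Proof.
case: f g => [f fP] [g gP] /= /funext fg; move: fP gP; rewrite fg => fP gP.
by congr Dual; apply: Prop_irrelevance.
Qed.

Lemma dual_scaleB (f : D) b (x : M) : f (iB b *: x) = b * f x.
Proof. exact: (linearZ_LR f). Qed.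

Fact dual_zero_linear : linear (fun _ : restrict iB M => 0 : B^o).
Proof. by move=> a x y; rewrite scaler0 addr0. Qed.
Fact dual_opp_linear (f : D) : linear (fun x : restrict iB M => - f x : B^o).
Proof. by move=> a x y; rewrite linearP opprD scalerN. Qed.
Fact dual_add_linear (f g : D) : linear (fun x : restrict iB M => f x + g x : B^o).
Proof. by move=> a x y; rewrite !linearP addrACA scalerDr. Qed.
Definition dual_zero := Dual dual_zero_linear.
Definition dual_opp f := Dual (dual_opp_linear f).
Definition dual_add f g := Dual (dual_add_linear f g).
Fact dual_addA : associative dual_add.
Proof. by move=> f g h; apply: dual_ext => x /=; rewrite addrA. Qed.
Fact dual_addC : commutative dual_add.
Proof. by move=> f g; apply: dual_ext => x /=; rewrite addrC. Qed.
Fact dual_add0 : left_id dual_zero dual_add.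
Proof. by move=> f; apply: dual_ext => x /=; rewrite add0r. Qed.
Fact dual_addN : left_inverse dual_zero dual_opp dual_add.
Proof. by move=> f; apply: dual_ext => x /=; rewrite addNr. Qed.
HB.instance Definition _ :=
  GRing.isZmodule.Build D dual_addA dual_addC dual_add0 dual_addN.

Fact dual_scale_linear (b : B) (f : D) :
  linear (fun x : restrict iB M => f (iA (op' b) *: (x : M)) : B^o).
Proof.
move=> c x y; rewrite -[c *: x + y]/((iB c *: (x : M)) + y).
rewrite scalerDr scalerA inAB_comm -scalerA.
exact: (linearP f).
Qed.
Definition dual_scale b f := Dual (dual_scale_linear b f).

Fact dual_scaleA b c f : dual_scale b (dual_scale c f) = dual_scale (b * c) f.
Proof. by apply: dual_ext => x /=; rewrite scalerA -rmorphM -op_invM. Qed.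
Fact dual_scale1 : left_id 1 dual_scale.
Proof. by move=> f; apply: dual_ext => x /=; rewrite op_inv1 rmorph1 scale1r. Qed.
Fact dual_scaleDr : right_distributive dual_scale +%R.
Proof. by move=> b f g; apply: dual_ext. Qed.
Fact dual_scaleDl f : {morph dual_scale^~ f : b c / b + c}.
Proof.
move=> b c; apply: dual_ext => x /=.
have -> : op' (b + c) = op' b + op' c.
  by have := op_inv_linear 1 b c; rewrite !scale1r.
by rewrite rmorphD scalerDl; apply: (linearD f).
Qed.
HB.instance Definition _ := GRing.Zmodule_isLmodule.Build B D
  dual_scaleA dual_scale1 dual_scaleDr dual_scaleDl.

Lemma dual_addE (f g : D) x : (f + g) x = f x + g x. Proof. by []. Qed.
Lemma dual_oppE (f : D) x : (- f) x = - f x. Proof. by []. Qed.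
Lemma dual_scaleE b (f : D) x : (b *: f) x = f (iA (op' b) *: (x : M)).
Proof. by []. Qed.

End Module.

Fact dual_map_linear_fun M N (g : {linear M -> N}) (f : dual X N) :
  linear (fun x : restrict iB M => f (g x)).
Proof. by move=> b x y; rewrite -(linearP f); congr (f _); apply: linearP. Qed.
Definition dual_map M N (g : {linear M -> N}) (f : dual X N) : dual X M :=
  Dual (dual_map_linear_fun g f).
Fact dual_map_linear M N (g : {linear M -> N}) : linear (dual_map g).
Proof.
move=> b f f'; apply: dual_ext => x; rewrite dual_addE [LHS]dual_addE.
by rewrite !dual_scaleE /= linearZ.
Qed.
HB.instance Definition _ M N (g : {linear M -> N}) :=
  GRing.isLinear.Build B (dual X N) (dual X M) *:%R (dual_map g) (dual_map_linear g).

Lemma dual_sum M (f : dual X M) (J : Type) (s : seq J) (F : J -> M) :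
  f (\sum_(j <- s) F j) = \sum_(j <- s) f (F j).
Proof. exact: (linear_sum f). Qed.

(** The extension to [E], for fixed y, of the formula that sends the product of
    a in [A] and b in [B] to b * w (op a *: y); see [coind_fun_tens]. These are
    the values that a family of functionals y |-> w y must take on the multiples
    of a generator. *)
Section Coinduction.
Variables (N' : lmodType B) (w : {linear restrict (in_alg B) N' -> B}).

Definition coind_fun (e : E) (y : N') : B :=
  \sum_i \sum_j tcoef X i j e *: (vb j * w (op X (vb i) *: y)).

Lemma coind_funDl y : {morph coind_fun^~ y : e e' / e + e'}.
Proof.
move=> e e'; rewrite /coind_fun -big_split; apply: eq_bigr => i _ /=.
by rewrite -big_split; apply: eq_bigr => j _; rewrite tcoefD scalerDl.
Qed.

Lemma coind_funDr e y y' : coind_fun e (y + y') = coind_fun e y + coind_fun e y'.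
Proof.
rewrite /coind_fun -big_split; apply: eq_bigr => i _ /=.
rewrite -big_split; apply: eq_bigr => j _ /=.
by rewrite [op X _ *: _]scalerDr (linearD w) mulrDr scalerDr.
Qed.

Lemma coind_fun_tens a b y : coind_fun (iA a * iB b) y = b * w (op X a *: y).
Proof.
have -> : w (op X a *: y) = \sum_i v2r a 0 i *: w (op X (vb i) *: y).
  have -> : op X a *: y = \sum_i (v2r a 0 i)%:A *: (op X (vb i) *: y).
    rewrite {1}[a]vb_sum linear_sum scaler_suml; apply: eq_bigr => i _.
    by rewrite linearZ_LR scalerA mulr_algl.
  by rewrite (linear_sum w); apply: eq_bigr => i _; apply: (linearZ_LR w).
rewrite mulr_sumr; apply: eq_bigr => i _.
rewrite -scalerAr [in RHS](vb_sum b) mulr_suml scaler_sumr; apply: eq_bigr => j _.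
by rewrite tcoef_tens -scalerAl scalerA.
Qed.

End Coinduction.

(** A linear map from [N] to [dual P] is determined by the k-linear functionals
    obtained by evaluating it on the dual basis vectors of [P]. These extend
    from [N] to [N'], and each family of extended functionals determines a
    linear map on [N']. *)
Lemma dual_injective P : fg_projective P -> injective_module (dual X P).
Proof.
case=> J [u [c cE]] N N' g f gI.
pose w0 j (y : restrict (in_alg B) N) : B := f y (u j).
have w0L j : linear (w0 j).
  move=> a x y; rewrite /w0.
  rewrite (_ : f (a *: x + y) = a%:A *: f x + f y); last exact: (linearP f).
  rewrite dual_addE dual_scaleE; congr (_ + _).
  rewrite op_inv_scalar.
  have -> : iA a%:A = iB a%:A by rewrite !linearZ !rmorph1.
  by rewrite dual_scaleB mulr_algl.
have /choice[w wE] j : exists w : {linear restrict (in_alg B) N' -> B},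
    forall y, w (g y) = w0 j y.
  have [v vE] := linear_map (w0L j).
  have [//|w wE] := @vector_space_injective k B _ _
    (@restrict_map _ _ (in_alg B) _ _ g : {linear _ -> _}) v.
  by exists w => y; rewrite -vE -wE.
pose h y (x : restrict iB P) : B^o := \sum_j coind_fun (w j) (c j x) y.
have coB (v : {linear restrict (in_alg B) N' -> B}) b e y :
    coind_fun v (iB b * e) y = b * coind_fun v e y.
  move: e; apply: (additive_tens_ext (X := X)) => [e e'|e e'|a b'].
  - by rewrite mulrDr coind_funDl.
  - by rewrite coind_funDl mulrDr.
  by rewrite mulrA -inAB_comm -mulrA -rmorphM !coind_fun_tens mulrA.
have coA (v : {linear restrict (in_alg B) N' -> B}) a e y :
    coind_fun v (iA a * e) y = coind_fun v e (op X a *: y).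
  move: e; apply: (additive_tens_ext (X := X)) => [e e'|e e'|a' b'].
  - by rewrite mulrDr coind_funDl.
  - by rewrite coind_funDl.
  by rewrite mulrA -rmorphM !coind_fun_tens opM scalerA.
have hL y : linear (h y).
  move=> b x x'; rewrite scaler_sumr -big_split; apply: eq_bigr => j _ /=.
  rewrite -[b *: x + x']/(iB b *: (x : P) + x') linearP coind_funDl.
  by congr (_ + _); apply: coB.
have [a y y'|H HE] := @linear_map _ N' (dual X P) (fun y => Dual (hL y)).
  apply: dual_ext => x; rewrite dual_addE dual_scaleE /= -big_split.
  apply: eq_bigr => j _ /=; rewrite coind_funDr linearZ_LR.
  by congr (_ + _); rewrite -[RHS]/(coind_fun _ (_ * _) _) coA op_invK.
exists H => y; apply: dual_ext => x; rewrite HE /= /h [in RHS](cE x) dual_sum.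
apply: eq_bigr => j _; move: (c j x); apply: (additive_tens_ext (X := X)) => [e e'|e e'|a b].
- exact: coind_funDl.
- by rewrite scalerDl; apply: (linearD (f y)).
rewrite coind_fun_tens -linearZ_LR wE /w0 inAB_comm -scalerA dual_scaleB.
congr (_ * _); rewrite (_ : f (op X a *: y) = op X a *: f y).
  by rewrite dual_scaleE opK.
exact: (linearZ_LR f).
Qed.

End Dual.

(** * Duals of syzygies of the regular bimodule *)

Lemma linear_inverse (R : nzRingType) (M N : lmodType R) (f : {linear M -> N}) :
  bijective f -> exists g : {linear N -> M}, cancel f g /\ cancel g f.
Proof.
move=> [g0 fK gK]; have [x|g gE] := factor_through_mono (f := idfun) (can_inj fK).
  by exists (g0 x); rewrite gK.
by exists g; split=> // x; apply: (can_inj fK); rewrite gE.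
Qed.

Lemma injective_coresolution (R : nzRingType) (I : lmodType R) :
  injective_module I -> finite_injective_coresolution 1 I.
Proof.
move=> Iinj; pose Z := kernel (@idfun I : {linear I -> I}).
have Z0 (z : Z) : z = 0.
  by apply: val_inj; have /eqP := valP z; rewrite linear0.
exists I, Z, idfun, \0; split=> //= y; last by exists 0; rewrite [RHS]Z0.
by split=> // _; exists y.
Qed.

Section Setting.
Variables (k : fieldType) (A B E : falgType k) (X : enveloping_setting A B E).
Local Notation iA := (inA X).
Local Notation iB := (inB X).
Implicit Types K L M N P Q : lmodType E.

(** The basis of [A] is a basis of [E] over [B]. *)
Lemma restrict_fg_projective P :
  fg_projective P -> fg_projective (restrict iB P : lmodType B).
Proof.
case=> J [u [c cE]].
pose c0 i (e : E) : B := \sum_j tcoef X i j e *: vb j.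
have c0D i : {morph c0 i : e e' / e + e'}.
  move=> e e'; rewrite /c0 -big_split; apply: eq_bigr => j _.
  by rewrite tcoefD scalerDl.
have c0_tens i a b : c0 i (iA a * iB b) = v2r a 0 i *: b.
  rewrite /c0 [in RHS](vb_sum b) scaler_sumr; apply: eq_bigr => j _.
  by rewrite tcoef_tens scalerA.
have c0B i b e : c0 i (iB b * e) = b * c0 i e.
  move: e; apply: (additive_tens_ext (X := X)) => [e e'|e e'|a b'].
  - by rewrite mulrDr c0D.
  - by rewrite c0D mulrDr.
  by rewrite mulrA -inAB_comm -mulrA -rmorphM !c0_tens scalerAr.
have c0E e : e = \sum_i iB (c0 i e) * iA (vb i).
  rewrite [LHS](tcoef_sum X); apply: eq_bigr => i _.
  rewrite /c0 rmorph_sum mulr_suml; apply: eq_bigr => j _.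
  rewrite inAB_comm scalerAl; congr (_ * _); symmetry; exact: (linearZ_LR iB).
have /choice[f fE] (ji : J * 'I_(dim A)) : exists f : {linear restrict iB P -> B^o},
    forall x, f x = c0 ji.2 (c ji.1 x).
  have [b x y|f fE] := @linear_map _ (restrict iB P) B^o (fun x => c0 ji.2 (c ji.1 x)).
    rewrite -[b *: x + y]/(iB b *: (x : P) + y) linearP c0D.
    by congr (_ + _); apply: c0B.
  by exists f.
exists (J * 'I_(dim A))%type, (fun ji => iA (vb ji.2) *: u ji.1), f => x.
rewrite [LHS](cE (x : P)).
transitivity (\sum_j \sum_i f (j, i) x *: (iA (vb i) *: u j : restrict iB P)).
  apply: eq_bigr => j _; rewrite {1}[c j x]c0E scaler_suml.
  by apply: eq_bigr => i _; rewrite fE -scalerA.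
by rewrite pair_bigA; apply: eq_bigr => -[j i] _.
Qed.

(** The invariant that makes the syzygies of a bimodule split presentations;
    it passes to syzygies. *)
Definition admissible M :=
  finite_dimensional M /\ fg_projective (restrict iB M : lmodType B).

(** As [M] is projective over [B], its projective cover splits over [B], and
    the kernel is a retract of a module that is projective over [B]. *)
Lemma admissible_syzygy M N : admissible M -> is_syzygy M N ->
  admissible N /\ exists P (p : {linear P -> M}) (i : {linear N -> P}),
    split_presentation X p i.
Proof.
case=> Mfd Mproj /(syzygy_finite_dimensional Mfd)[P [p [i [Pproj pE iI ex]]]].
pose pB := @restrict_map _ _ iB _ _ p : {linear _ -> _}.
pose iB' := @restrict_map _ _ iB _ _ i : {linear _ -> _}.
have [|s sE] := @fg_projective_lift _ _ _ _ pB idfun Mproj; first exact: pE.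
have [x|r rE] := @factor_through_mono _ _ _ _ iB' (idfun \- (s \o pB)) iI.
  by apply/ex; rewrite -[LHS]/(pB _) linearB /= sE subrr.
have rK y : r (i y) = y.
  apply: iI; rewrite -[LHS]/(iB' _) rE /= (_ : pB (i y) = 0); first last.
    by apply/ex; exists y.
  by rewrite linear0 subr0.
split; last by exists P, p, i; split=> //; exists r.
split; first exact/(finite_dimensional_sub iI)/fg_projective_finite_dimensional.
have [J [u [c cE]]] := restrict_fg_projective Pproj.
exists J, (fun j => r (u j)), (fun j => c j \o iB') => y.
rewrite -[LHS]rK [in LHS](cE (i y)) linear_sum; apply: eq_bigr => j _.
by rewrite linearZ_LR.
Qed.

Lemma admissible_iso M N : linear_iso M N -> admissible M -> admissible N.
Proof.
case=> f /linear_inverse[g [fK gK]] [Mfd [J [u [c cE]]]].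
split; first exact: finite_dimensional_sub (can_inj gK) Mfd.
pose fB := @restrict_map _ _ iB _ _ f : {linear _ -> _}.
pose gB := @restrict_map _ _ iB _ _ g : {linear _ -> _}.
exists J, (fun j => fB (u j)), (fun j => c j \o gB) => y.
rewrite -[LHS]gK -[LHS]/(fB (g y)) [in LHS](cE (g y)) linear_sum.
by apply: eq_bigr => j _; rewrite linearZ_LR.
Qed.

Lemma admissible_nth_syzygy n M N : admissible M -> is_nth_syzygy n M N ->
  admissible N /\ syzygy_chain X n M N.
Proof.
move=> Mad; elim: n N => [|n IH] N /=.
  by move=> MN; split=> //; apply: admissible_iso Mad.
case=> L [/IH[Lad chain] /(admissible_syzygy Lad)[Nad [P [p [i pres]]]]].
by split=> //; exists L, P, p, i.
Qed.

Lemma syzygy_chain_iso n M N N' :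
  linear_iso N N' -> syzygy_chain X n M N -> syzygy_chain X n M N'.
Proof.
case=> f fB; case: n => [|n] /=.
  by case=> g gB; exists (f \o g); apply: bij_comp.
have [g [fK gK]] := linear_inverse fB.
case=> L [P [p [i [chain [Pproj pE iI ex [r rK]]]]]].
exists L, P, p, (i \o g); split=> //; split=> //.
- exact: inj_comp iI (can_inj gK).
- move=> x; rewrite ex; split=> [[y <-]|[y <-]]; last by exists (g y).
  by exists (f y); rewrite /= fK.
exists (@restrict_map _ _ iB _ _ f \o r) => y /=.
by rewrite rK; apply: gK.
Qed.

Lemma syzygy_chain_trans m n L M N :
  syzygy_chain X m L M -> syzygy_chain X n M N -> syzygy_chain X (m + n) L N.
Proof.
move=> LM; elim: n N => [|n IH] N; first by rewrite addn0 => /syzygy_chain_iso; apply.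
case=> K [P [p [i [chain pres]]]]; rewrite addnS.
by exists K, P, p, i; split=> //; apply: IH.
Qed.

Lemma syzygy_chain_split m n L N : syzygy_chain X (m + n) L N ->
  exists M, syzygy_chain X n M N.
Proof.
elim: n N => [|n IH] N; first by exists N, idfun; exists idfun.
rewrite addnS; case=> K [P [p [i [/IH[M chain] pres]]]].
by exists M, K, P, p, i.
Qed.

(** [dual] is contravariant and exact on sequences that split over [B]. *)
Lemma dual_exact M N P (p : {linear P -> M}) (i : {linear N -> P}) :
    split_presentation X p i ->
  [/\ injective (@dual_map _ _ _ _ X _ _ p),
      exact_at (@dual_map _ _ _ _ X _ _ p) (@dual_map _ _ _ _ X _ _ i)
    & epi (@dual_map _ _ _ _ X _ _ i)].
Proof.
case=> _ pE _ ex [r rK]; split.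
- move=> f g fg; apply: dual_ext => y; have [x <-] := pE y.
  by have := congr1 (fun h : dual X P => h x) fg.
- move=> f; split=> [f0|[g <-]]; last first.
    apply: dual_ext => y /=; rewrite (_ : p (i y) = 0) ?linear0 //.
    by apply/ex; exists y.
  pose pB := @restrict_map _ _ iB _ _ p : {linear _ -> _}.
  have [|g gE] := @factor_through_epi _ _ _ _ pB f pE.
    move=> x /ex[y <-]; exact: (congr1 (fun h : dual X N => (h : _ -> B) y) f0).
  by exists (Dual (linearP g)); apply: dual_ext => x /=; apply: gE.
move=> f; exists (Dual (linearP (f \o r))); apply: dual_ext => y /=.
by rewrite rK.
Qed.

(** [S] stands for the regular bimodule, identified with [B] by [theta]. *)
Variables (S : lmodType E) (theta : {linear restrict iB S -> B^o}).
Hypothesis theta_bij : bijective theta.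
Hypothesis thetaA : forall a (x : S), theta (iA a *: x) = theta x * op X a.

Lemma theta_generator theta' b :
  cancel theta' theta -> theta (iB b *: (theta' 1 : S)) = b.
Proof.
move=> theta'K; apply: etrans (linearZ_LR theta _ _) _.
by rewrite theta'K; apply: mulr1.
Qed.

(** The core of the argument: any bimodule map phi from a deep syzygy N to an
    n-th syzygy K of [S] becomes, after applying [dual], a map that lifts to the
    dual of the projective P containing N. For n = 0 the source is the free
    module [dual S]. In the inductive step, phi extends to the projectives by
    vanishing of Ext, so it induces a map phi0 between the preceding syzygies,
    for which a lift h0 is known. Extending h0 to the injective module [dual Q]
    gives a homotopy, and subtracting it from the dual of Phi yields a map G
    that vanishes on [dual K0], hence factors through [dual K]. *)
Lemma lift_dual d n m K L M N P (p : {linear P -> M}) (i : {linear N -> P})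
    (phi : {linear N -> K}) :
    finite_injective_coresolution d (A^o : lmodType A) -> (d <= m)%N ->
    syzygy_chain X n S K -> syzygy_chain X (m + n) L M ->
    split_presentation X p i ->
  exists h : {linear dual X K -> dual X P}, forall f y, h f (i y) = f (phi y).
Proof.
move=> cor dm; elim: n K M N P p i phi => [|n IH] K M N P p i phi.
  case=> g /linear_inverse[g' [gK g'K]] _ [_ _ _ _ [r rK]].
  have [theta' thetaK theta'K] := theta_bij.
  (* [dual K] is free on one element whose value at k0 is 1, so f is determined
     by its value at k0. [T] is a lift of that basis element. *)
  pose k0 : K := g (theta' 1).
  pose T : dual X P := Dual (linearP (theta \o @restrict_map _ _ iB _ _ (g' \o phi) \o r)).
  have [b f f'|h hE] := @linear_map _ (dual X K) (dual X P) (fun f => f k0 *: T).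
    rewrite scalerA -scalerDl dual_addE dual_scaleE; congr ((_ + _) *: _).
    have -> : iA (op_inv X b) *: k0 = iB b *: k0.
      rewrite -[LHS](linearZ_LR g) -[RHS](linearZ_LR g); congr (g _); apply: (bij_inj theta_bij).
      rewrite thetaA op_invK theta'K mul1r.
      by rewrite theta_generator.
    by rewrite dual_scaleB.
  exists h => f y; rewrite hE dual_scaleE /= -linearZ_LR rK /restrict_map /=.
  rewrite !linearZ_LR thetaA op_invK -dual_scaleB; congr (f _).
  rewrite /k0 -linearZ_LR -[RHS]g'K; congr (g _); apply: (bij_inj theta_bij).
  by rewrite theta_generator.
case=> K0 [P' [p' [i' [chainK pres']]]]; rewrite addnS => chainM pres.
have [K' chainK'] : exists K', syzygy_chain X d K' M.
  by apply: (syzygy_chain_split (m := m - d + n.+1) (L := L)); rewrite addnAC subnK ?addnS.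
have [P'proj p'E _ ex' _] := pres'; have [_ pE _ ex _] := pres.
case: chainM => M1 [Q [q [i1 [chainM pres1]]]]; have [Qproj _ _ _ _] := pres1.
have [Phi PhiE] := extend_to_projective (i' \o phi) cor chainK' pres P'proj.
have [|phi0 phi0E] := factor_through_epi (f := p' \o Phi) pE.
  by move=> x /ex[y <-] /=; rewrite PhiE; apply/ex'; exists (phi y).
have [h0 h0E] := IH _ _ _ _ _ _ phi0 chainK chainM pres1.
have [p'I dex di'E] := dual_exact pres'.
have [H HE] := dual_injective (X := X) Qproj h0 p'I.
pose G : {linear dual X P' -> dual X P} :=
  dual_map Phi \- (dual_map p \o dual_map i1 \o H).
have [f /dex[f0 <-]|h hE] := factor_through_epi (f := G) di'E.
  apply: dual_ext => x; rewrite dual_addE dual_oppE /= HE h0E.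
  by rewrite phi0E subrr.
exists h => f y; have [f' <-] := di'E f.
rewrite hE dual_addE dual_oppE /= PhiE (_ : p (i y) = 0); last first.
  by apply/ex; exists y.
by rewrite !linear0 addr0.
Qed.

(** Applied to the identity of a periodic syzygy, [lift_dual] exhibits its dual
    as a retract of the injective module [dual P]. *)
Lemma dual_periodic_injective d n m N :
    finite_injective_coresolution d (A^o : lmodType A) -> (d <= m)%N ->
    syzygy_chain X n S N -> syzygy_chain X (m + n).+1 N N ->
  injective_module (dual X N).
Proof.
move=> cor dm chainS [M [P [p [i [chainN pres]]]]].
have [h hE] := lift_dual idfun cor dm chainS chainN pres.
have [Pproj _ _ _ _] := pres.
apply: (injective_retract (s := h) (r := dual_map i)).
  exact: dual_injective.
by move=> f; apply: dual_ext => y; apply: hE.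
Qed.

(** The functional [theta] is a basis of [dual S]. *)
Lemma dual_regular : exists f : {linear B^o -> dual X S}, bijective f.
Proof.
have [theta' thetaK theta'K] := theta_bij.
pose T : dual X S := Dual (linearP theta).
have [a x y|f fE] := @linear_map _ B^o (dual X S) (fun b => b *: T).
  by rewrite scalerDl -scalerA.
exists f; exists (fun g : dual X S => g (theta' 1)) => [b|g].
  by rewrite fE dual_scaleE /= thetaA op_invK theta'K mul1r.
apply: dual_ext => x; rewrite fE dual_scaleE /= thetaA op_invK -dual_scaleB.
congr (g _); apply: (bij_inj theta_bij).
by rewrite theta_generator.
Qed.

(** The terms of the coresolution are the duals of the projectives in a
    resolution of [S], and [dual S] is the regular module. *)
Lemma dual_coresolution e n K : finite_injective_coresolution e (dual X K) ->
  syzygy_chain X n S K ->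
  exists e', finite_injective_coresolution e' (B^o : lmodType B).
Proof.
elim: n e K => [|n IH] e K cor.
  case=> g /linear_inverse[g' [gK g'K]]; exists e.
  have [f fB] := dual_regular.
  apply: coresolution_iso fB _.
  apply: (coresolution_iso (f := dual_map g')) cor.
  by exists (dual_map g) => h; apply: dual_ext => x /=; rewrite ?gK ?g'K.
case=> L [P [p [i [chain pres]]]].
apply: (IH e.+1) chain; have [pI ex iE] := dual_exact pres; have [Pproj _ _ _ _] := pres.
exists (dual X P), (dual X K), (dual_map p), (dual_map i); split=> //.
exact: dual_injective.
Qed.

(** The periodic syzygy is a syzygy of itself at every multiple of its period,
    so some multiple leaves room for the n steps of [lift_dual] beyond the
    injective dimension of [A]. *)
Theorem finite_inj_dim_transfer : finite_dimensional S ->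
  eventually_periodic S -> finite_inj_dim (A^o : lmodType A) ->
  finite_inj_dim (B^o : lmodType B).
Proof.
move=> Sfd [n [N [SN [q [N' [q0 NN' N'N]]]]]] [d /inj_dim_coresolution cor].
have Sad : admissible S.
  split=> //; have [theta' thetaK theta'K] := theta_bij.
  exists unit, (fun=> theta' 1), (fun=> theta) => x.
  rewrite (big_pred1 tt); last by case.
  apply: (bij_inj theta_bij); rewrite linearZ_LR theta'K.
  by rewrite -[LHS]mulr1.
have [Nad chainS] := admissible_nth_syzygy Sad SN.
have [_ /(syzygy_chain_iso N'N) chainN] := admissible_nth_syzygy Nad NN'.
have chainNr a : syzygy_chain X (a * q) N N.
  elim: a => [|a IH]; first by exists idfun; exists idfun.
  by rewrite mulSn; apply: syzygy_chain_trans chainN IH.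
pose c := ((n.+1 + d.+1) * q)%N.
have le_c : (n.+1 + d.+1 <= c)%N by rewrite leq_pmulr.
have le_nc : (n.+1 <= c)%N by apply: leq_trans le_c; apply: leq_addr.
have Ninj : injective_module (dual X N).
  apply: (dual_periodic_injective (m := c - n.+1) cor _ chainS).
    by rewrite leq_subRL //.
  by rewrite -addnS subnK //; apply: chainNr.
have [e /coresolution_inj_dim] := dual_coresolution (injective_coresolution Ninj) chainS.
by exists e.
Qed.

End Setting.

(** * The two orders of the factors of the enveloping algebra *)

Section Enveloping.
Variables (k : fieldType) (L : falgType k).
Local Notation E := (enveloping L).

Lemma envM (a b : L) (a' b' : L^c) :
  (tens a a' : E) * (tens b b' : E) = tens (a * b) (a' * b' : L^c).
Proof. exact: tens_mulE. Qed.

Definition inl_env (a : L) : E := tens a (1 : L^c).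
Fact inl_env_linear : linear inl_env.
Proof. by move=> c a b; rewrite /inl_env tensDl tensZl. Qed.
HB.instance Definition _ := GRing.isLinear.Build k L E *:%R inl_env inl_env_linear.
Fact inl_env_monoid : monoid_morphism inl_env.
Proof. by split=> // a b; rewrite /inl_env envM mulr1. Qed.
HB.instance Definition _ := GRing.isMonoidMorphism.Build L E inl_env inl_env_monoid.

Definition inr_env (a : L^c) : E := tens (1 : L) a.
Fact inr_env_linear : linear inr_env.
Proof. by move=> c a b; rewrite /inr_env tensDr tensZr. Qed.
HB.instance Definition _ := GRing.isLinear.Build k L^c E *:%R inr_env inr_env_linear.
Fact inr_env_monoid : monoid_morphism inr_env.
Proof. by split=> // a b; rewrite /inr_env envM mulr1. Qed.
HB.instance Definition _ := GRing.isMonoidMorphism.Build L^c E inr_env inr_env_monoid.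

Lemma inl_inr a b : inl_env a * inr_env b = tens a b.
Proof. by rewrite envM mulr1 mul1r. Qed.

Lemma inr_inl a b : inr_env b * inl_env a = tens a b.
Proof. by rewrite envM mulr1 mul1r. Qed.

Lemma tens_coef (a : L) (b : L^c) i j : (tens a b : E) i j = v2r a 0 i * v2r b 0 j.
Proof. by rewrite mxE big_ord1 mxE. Qed.

Lemma coefD_env i j : {morph (fun x : E => x i j) : x y / x + y}.
Proof. by move=> x y; rewrite mxE. Qed.

Definition to_conv (a : L) : L^c := a.
Fact to_conv_linear : linear to_conv. Proof. by []. Qed.
HB.instance Definition _ := GRing.isLinear.Build k L L^c *:%R to_conv to_conv_linear.
Definition of_conv (a : L^c) : L := a.
Fact of_conv_linear : linear of_conv. Proof. by []. Qed.
HB.instance Definition _ := GRing.isLinear.Build k L^c L *:%R of_conv of_conv_linear.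

Lemma inl_inr_comm a b : inl_env a * inr_env b = inr_env b * inl_env a.
Proof. by rewrite inl_inr inr_inl. Qed.

Lemma inl_inr_coef i j a b :
  (inl_env a * inr_env b) i j = v2r a 0 i * v2r b 0 j.
Proof. by rewrite inl_inr tens_coef. Qed.

Lemma inr_inl_coef i j b a :
  (inr_env b * inl_env a) j i = v2r b 0 i * v2r a 0 j.
Proof. by rewrite inr_inl tens_coef mulrC. Qed.

Lemma inl_inr_sum (e : E) :
  e = \sum_i \sum_j e i j *: (inl_env (vb i) * inr_env (vb j)).
Proof.
rewrite [LHS](tens_sum e); apply: eq_bigr => i _; apply: eq_bigr => j _.
by rewrite inl_inr.
Qed.

Lemma inr_inl_sum (e : E) :
  e = \sum_i \sum_j e j i *: (inr_env (vb i) * inl_env (vb j)).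
Proof.
rewrite [LHS]inl_inr_sum exchange_big; apply: eq_bigr => i _; apply: eq_bigr => j _.
by rewrite inl_inr_comm.
Qed.

(** In both settings the anti-isomorphism is the identity of the underlying
    space. *)
Definition left_setting : enveloping_setting L L^c E :=
  @EnvelopingSetting k L L^c E inl_env inr_env (fun i j x => x i j) to_conv of_conv
    inl_inr_comm coefD_env inl_inr_coef inl_inr_sum (fun _ _ => erefl)
    (fun _ => erefl) (fun _ => erefl).

Definition right_setting : enveloping_setting L^c L E :=
  @EnvelopingSetting k L^c L E inr_env inl_env (fun i j x => x j i) of_conv to_conv
    (fun b a => esym (inl_inr_comm a b)) (fun i j => coefD_env j i) inr_inl_coef
    inr_inl_sum (fun _ _ => erefl) (fun _ => erefl) (fun _ => erefl).

Lemma regular_finite_dimensional :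
  finite_dimensional (regular_bimodule L : lmodType E).
Proof.
exists L, id; split=> // c x y; congr (_ + _).
have -> : c%:A = tens (c *: 1 : L) (1 : L^c) :> E by rewrite tensZl.
by rewrite -[LHS]/(bimod_scale _ _) bimod_scaleE mulr1 -scalerAl mul1r.
Qed.

End Enveloping.

Theorem proposition5p5 (k : fieldType) (L : falgType k)
    (ep : eventually_periodic_algebra L) :
  finite_inj_dim (L^o : lmodType L) <-> finite_inj_dim (L^c^o : lmodType L^c).
Proof.
pose S : lmodType (enveloping L) := regular_bimodule L.
have Sfd : finite_dimensional S := regular_finite_dimensional L.
(* In both cases theta is the identity: the regular bimodule restricts to the
   regular module on either side. *)
split.
  have [a x y|theta thetaE] := @linear_map L^c (restrict (@inr_env k L) S) L^c^o id.
    congr (_ + _); rewrite -[LHS]/(bimod_scale _ _) bimod_scaleE mul1r.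
    by [].
  apply: (@finite_inj_dim_transfer _ _ _ _ (left_setting L) S theta) => //.
    by exists id => x; rewrite ?thetaE.
  move=> a x; rewrite !thetaE -[LHS]/(bimod_scale _ _) bimod_scaleE mulr1.
  by [].
have [a x y|theta thetaE] := @linear_map L (restrict (@inl_env k L) S) L^o id.
  congr (_ + _); rewrite -[LHS]/(bimod_scale _ _) bimod_scaleE mulr1.
  by [].
apply: (@finite_inj_dim_transfer _ _ _ _ (right_setting L) S theta) => //.
  by exists id => x; rewrite ?thetaE.
move=> a x; rewrite !thetaE -[LHS]/(bimod_scale _ _) bimod_scaleE mul1r.
by [].
Qed.
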